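(* Let $n\geq 9$ and let $G$ be a graph with vertex set $\mathbb{N}_n$. Then $G\in\mathcal{P}_{-1}$ if and only if $G-n=P_{n-1}$ and either $N_G(n)=\{k\}$ where $k\in\{3,\dots,n-3\}\cup\{1,n-1\}$, or $N_G(n)=\{k,k+1\}$ where $k\in\{2,\dots,n-3\}$.
   Context: Graphs are finite, simple and undirected; $G-X=G[V(G)\setminus X]$ is the subgraph induced by $V(G)\setminus X$, $G-x=G-\{x\}$, and $N_G(x)$ is the set of vertices adjacent to $x$ in $G$. A subset $I\subseteq V(G)$ is an interval of $G$ if every vertex outside $I$ is adjacent to all or to none of the vertices of $I$. The sets $\emptyset$, $V(G)$ and $\{x\}$ ($x\in V(G)$) are the trivial intervals. $G$ is indecomposable if all its intervals are trivial. For an indecomposable graph $G=(V,E)$, the indecomposability graph $\mathbb{I}(G)$ has vertex set $V$, and its edges are the pairs $\{x,y\}$ of distinct vertices such that $G-\{x,y\}$ is indecomposable. A graph $H$ is $X$-covered, for $X\subseteq V(H)$, if every edge of $H$ meets $X$. Let $\mathbb{N}_n=\{1,\dots,n\}$. $P_n$ is the graph on $\mathbb{N}_n$ in which $i\ne j$ are adjacent iff $|i-j|=1$. $\mathcal{P}_{-1}$ is the set of indecomposable graphs $G$ with vertex set $\mathbb{N}_n$ for some $n\geq 9$ such that $\mathbb{I}(G)$ is $\{1,n-1\}$-covered and $G-n=P_{n-1}$. *)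

(* Defs.v *)
(* MathComp, with finite sets over a choiceType from mathcomp-finmap. *)
From mathcomp Require Import all_boot finmap.

Set Implicit Arguments.
Unset Strict Implicit.
Unset Printing Implicit Defensive.

Local Open Scope fset_scope.

(* The edges are two-element sets of vertices.  [edges_wf] is a boolean, so
   Leibniz equality of graphs is equality of vertex sets and of edge sets. *)
Record sgraph (K : choiceType) := SGraph {
  verts : {fset K};
  edges : {fset {fset K}};
  edges_wf : edges `<=` [fset e in fpowerset verts | #|` e| == 2]
}.

Section Graphs.
Variable K : choiceType.
Implicit Types (G H : sgraph K) (V X I : {fset K}) (r : rel K).

Definition adj G : rel K := fun x y => [fset x; y] \in edges G.

Definition rel_edges V r : {fset {fset K}} :=
  [fset e in fpowerset V |
     (#|` e| == 2) && [forall x : e, forall y : e,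
                         (val x != val y) ==> r (val x) (val y)]].

Lemma rel_edges_wf V r :
  rel_edges V r `<=` [fset e in fpowerset V | #|` e| == 2].
Proof. by apply/fsubsetP => e; rewrite !inE => /and3P [-> ->]. Qed.

(* Meant for r symmetric on V: {x, y} is an edge iff x and y are distinct
   elements of V with r x y and r y x. *)
Definition rel_graph V r : sgraph K := SGraph (rel_edges_wf V r).

Lemma adj_rel_graph V r x y :
  adj (rel_graph V r) x y = [&& x \in V, y \in V, x != y, r x y & r y x].
Proof.
rewrite /adj /= /rel_edges !inE /= fpowersetE fsubUset !fsub1set cardfs2 -!andbA.
case: (x \in V) => //=; case: (y \in V) => //=.
have [->|nxy] /= := eqVneq x y => //.
apply/idP/andP => [/forallP H | [rxy ryx]].
  have xin : x \in [fset x; y] by rewrite !inE eqxx.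
  have yin : y \in [fset x; y] by rewrite !inE eqxx orbT.
  have /forallP /(_ [` yin]) /= := H [` xin]; rewrite nxy => /= ->.
  by have /forallP /(_ [` xin]) /= := H [` yin]; rewrite eq_sym nxy => /= ->.
apply/forallP => -[a a_in]; apply/forallP => -[b b_in] /=.
move: a_in b_in; rewrite !inE.
by move=> /orP [] /eqP -> /orP [] /eqP ->; rewrite ?eqxx //= ?rxy ?ryx implybT.
Qed.

Definition induced G X : sgraph K := rel_graph (verts G `&` X) (adj G).

Definition del_verts G X : sgraph K := induced G (verts G `\` X).

Definition neighbors G x : {fset K} := [fset y in verts G | adj G x y].

Definition is_interval G I : bool :=
  (I `<=` verts G) &&
  [forall x : verts G, (val x \notin I) ==>
     ([forall y : I, adj G (val x) (val y)]
      || [forall y : I, ~~ adj G (val x) (val y)])].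

Definition trivial_interval G I : bool :=
  [|| I == fset0, I == verts G | [exists x : verts G, I == [fset val x]]].

Definition indecomposable G : bool :=
  [forall I : fpowerset (verts G),
     is_interval G (val I) ==> trivial_interval G (val I)].

Definition indec_graph G : sgraph K :=
  rel_graph (verts G) (fun x y => indecomposable (del_verts G [fset x; y])).

Definition covered X H : Prop :=
  forall e, e \in edges H -> exists2 x, x \in e & x \in X.

End Graphs.

Definition N_ (n : nat) : {fset nat} := [fset i in iota 1 n].

Definition path_graph (n : nat) : sgraph nat :=
  rel_graph (N_ n) (fun i j => (j == i.+1) || (i == j.+1)).

Definition P_minus1 (G : sgraph nat) : Prop :=
  exists n : nat,
    [/\ 9 <= n, verts G = N_ n, indecomposable G,
        covered [fset 1; n.-1] (indec_graph G)
      & del_verts G [fset n] = path_graph n.-1].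

(* Main.v *)
(* Let S be the set of neighbours of n on the path 1, ..., n - 1.  If S is a
   vertex k, or a pair k, k + 1, removing two inner path vertices (or an inner
   path vertex and n) disconnects G, so the indecomposability graph is
   covered; G itself is indecomposable unless n is a twin of a path vertex.
   Conversely, let a and b be the least and greatest elements of S.  If
   b = a + 2 then n is a twin of a + 1.  If b >= a + 3, consider
   G - {a + 1, a + 2} and G - {b - 2, b - 1}: each is two paths joined through
   n, and can only fail to be indecomposable when S contains one of the two
   paths or does not separate the ends of one with three vertices.  Since
   n >= 9, both fail only if S is the whole path, when G is decomposable. *)
Require Import Defs.
From mathcomp Require Import all_boot finmap zify.
From Stdlib Require Import Classical.

(** * Intervals of a path, and two paths joined through a vertex *)

Definition interval_on {K : choiceType} (V : {fset K}) (r : rel K) (I : pred K) :=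
  (forall x, I x -> x \in V) /\
  (forall x y z, x \in V -> ~~ I x -> I y -> I z -> r x y = r x z).

(** Indecomposability with the vertex set kept apart from the relation, so that $G-X$ can be treated
    with the adjacency of $G$. Empty and one-element intervals are merged into one case. *)
Definition prime_on {K : choiceType} (V : {fset K}) (r : rel K) :=
  forall I : pred K, interval_on V r I ->
    (forall x y, I x -> I y -> x = y) \/ (forall x, x \in V -> I x).

Definition path_adj : rel nat := fun x y => (y == x.+1) || (x == y.+1).

Lemma path_adj_closed (l r b : nat) (X : pred nat) :
  (forall x y, l <= x <= r -> l <= y <= r -> path_adj x y -> X x -> X y) ->
  l <= b <= r -> X b -> forall x, l <= x <= r -> X x.
Proof.
move=> H bI Xb.
have up k : b + k <= r -> X (b + k).
  elim: k => [|k IH] hk; first by rewrite addn0.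
  by apply: (H (b + k)); rewrite /path_adj; [lia|lia|lia|apply: IH; lia].
have down k : l + k <= b -> X (b - k).
  elim: k => [|k IH] hk; first by rewrite subn0.
  by apply: (H (b - k)); rewrite /path_adj; [lia|lia|lia|apply: IH; lia].
move=> x xI; have [bx|xb] := leqP b x.
  by have := up (x - b); rewrite subnKC //; apply; lia.
by have := down (b - x); rewrite subKn; [apply; lia|lia].
Qed.

(** Let p < q be the extreme elements of I. If l < p, then p - 1 is adjacent to p but not to q;
    hence p = l and, symmetrically, q = r. A vertex outside I with a path neighbour in I is then
    adjacent to both l and r, so r = l + 2; without such a vertex, connectedness fills the path. *)
Lemma path_interval (l r : nat) (I : pred nat) :
  (forall x, I x -> l <= x <= r) ->
  (forall x y z, l <= x <= r -> ~~ I x -> I y -> I z ->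
     path_adj x y = path_adj x z) ->
  [\/ forall x y, I x -> I y -> x = y,
      forall x, l <= x <= r -> I x
    | [/\ r = l.+2, I l & I r]].
Proof.
move=> IV II.
have [/hasP [u uI /hasP [v vI /and3P [Iu Iv uv]]]|] :=
  boolP (has (fun u => has (fun v => [&& I u, I v & u < v]) (iota 0 r.+1)) (iota 0 r.+1)); last first.
  move=> /hasPn H; constructor 1 => x y Ix Iy.
  have := IV _ Ix; have := IV _ Iy => yr xr.
  have /H /hasPn /(_ y) : x \in iota 0 r.+1 by rewrite mem_iota; lia.
  have /H /hasPn /(_ x) : y \in iota 0 r.+1 by rewrite mem_iota; lia.
  by rewrite !mem_iota Ix Iy; lia.
have [p Ip pmin] := ex_minnP (ex_intro I u Iu).
have [|q Iq qmax] := ex_maxnP (ex_intro I u Iu) (m := r).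
  by move=> x /IV; lia.
have pu := pmin _ Iu; have vq := qmax _ Iv.
have pV := IV _ Ip; have qV := IV _ Iq.
have pl : p = l.
  have [//|pl] := eqVneq p l.
  have := II p.-1 p q; rewrite /path_adj; case: (boolP (I p.-1)) => [/pmin|_]; first by lia.
  by move=> H; have := H _ isT Ip Iq; lia.
have qr : q = r.
  have [//|qr] := eqVneq q r.
  have := II q.+1 p q; rewrite /path_adj; case: (boolP (I q.+1)) => [/qmax|_]; first by lia.
  by move=> H; have := H _ isT Ip Iq; lia.
subst p q.
have [rl|rl] := eqVneq r l.+2; first by constructor 3.
constructor 2; apply: (path_adj_closed l r l) => [x y xI yI xy Ix||//]; last by lia.
apply/negPn/negP => nIy.
have nyl : y != l by apply: contraNneq nIy => ->.
have nyr : y != r by apply: contraNneq nIy => ->.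
have := II y x l yI nIy Ix Ip; have := II y x r yI nIy Ix Iq.
by move: xy; rewrite /path_adj; lia.
Qed.

(* A nontrivial interval of the path l, ..., r is the whole path or, when the
   path has three vertices, its pair of ends; a segment is bad when the vertex
   with neighbourhood S does not destroy such an interval. *)
Definition bad_segment (l r : nat) (S : pred nat) :=
  (l < r /\ (forall x, l <= x <= r -> S x)) \/ (r = l.+2 /\ S l = S r).

(** If I contains n and another vertex, then I contains a or b from the opposite segment, since
    these are adjacent to n but not to that vertex; closure then fills everything. If I misses n,
    then n is constant on I, and any nontrivial I makes a segment bad. *)
Lemma two_segments (V : {fset nat}) (e : rel nat) (i m n a b : nat) :
  symmetric e -> 6 <= m -> m < n ->
  (forall x, (x \in V) = [|| 1 <= x <= i, i.+3 <= x <= m | x == n]) ->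
  (forall x y, 1 <= x <= m -> 1 <= y <= m -> e x y = path_adj x y) ->
  1 <= a <= i -> e n a -> i.+3 <= b <= m -> e n b ->
  prime_on V e \/ bad_segment 1 i (e n) \/ bad_segment i.+3 m (e n).
Proof.
move=> eC m6 mn VE eP aA ea bC eb.
have [bA|nbA] := classic (bad_segment 1 i (e n)); first by right; left.
have [bC'|nbC] := classic (bad_segment i.+3 m (e n)); first by right; right.
left=> I [IV II].
(* A vertex of I in one segment is adjacent to nothing in the other, so I is
   closed under path adjacency in the other segment. *)
have absA y : I y -> i.+3 <= y <= m -> forall x, 1 <= x <= i -> I x ->
    forall x, 1 <= x <= i -> I x.
  move=> Iy yC x xA Ix; apply: (path_adj_closed 1 i x) => // u v uA vA uv Iu.
  apply/negPn/negP => nIv.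
  have := II v u y; rewrite VE vA => /(_ isT nIv Iu Iy).
  rewrite !eP; move: uv; rewrite /path_adj; lia.
have absC y : I y -> 1 <= y <= i -> forall x, i.+3 <= x <= m -> I x ->
    forall x, i.+3 <= x <= m -> I x.
  move=> Iy yC x xA Ix; apply: (path_adj_closed i.+3 m x) => // u v uA vA uv Iu.
  apply/negPn/negP => nIv.
  have := II v u y; rewrite VE vA orbT => /(_ isT nIv Iu Iy).
  rewrite !eP; move: uv; rewrite /path_adj; lia.
have [In|nIn] := boolP (I n).
  have toC x : I x -> 1 <= x <= i -> I b.
    move=> Ix xA; apply/negPn/negP => nIb.
    have := II b n x; rewrite VE bC orbT => /(_ isT nIb In Ix).
    by rewrite eC eb eP /path_adj; lia.
  have toA x : I x -> i.+3 <= x <= m -> I a.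
    move=> Ix xC; apply/negPn/negP => nIa.
    have := II a n x; rewrite VE aA => /(_ isT nIa In Ix).
    by rewrite eC ea eP /path_adj; lia.
  have full : I a -> I b -> forall x, x \in V -> I x.
    move=> Ia Ib x; rewrite VE => /or3P [xA|xC|/eqP -> //].
      exact: (absA b Ib bC a aA Ia).
    exact: (absC a Ia aA b bC Ib).
  have only x y : I x -> x != n -> y \in V -> I y.
    move=> Ix xn yV; have := IV _ Ix; rewrite VE (negbTE xn) orbF.
    case/orP => xI.
      by have Ib := toC x Ix xI; apply: full => //; apply: (toA b).
    by have Ia := toA x Ix xI; apply: full => //; apply: (toC a).
  have [/hasP [x _ /andP [Ix xn]]|/hasPn H] :=
    boolP (has (fun x => I x && (x != n)) V).
    by right=> y; apply: only Ix xn.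
  left; have all x : I x -> x = n.
    by move=> Ix; have := H x (IV _ Ix); rewrite Ix /= negbK => /eqP.
  by move=> x y /all -> /all ->.
have nE y z : I y -> I z -> e n y = e n z.
  by apply: II => //; rewrite VE eqxx !orbT.
have IAC x : I x -> 1 <= x <= i \/ i.+3 <= x <= m.
  by move=> Ix; have := IV _ Ix; rewrite VE;
     case: (eqVneq x n) => [xn|_]; [rewrite -xn Ix in nIn | lia].
have meet x y : I x -> I y -> 1 <= x <= i -> i.+3 <= y <= m -> False.
  move=> Ix Iy xA yC.
  have A := absA y Iy yC x xA Ix; have C := absC x Ix xA y yC Iy.
  (* A bad segment needs two vertices: if i = 1, the other segment 4, ..., m has them because m >=
     6. *)
  have [i2|i2] := leqP 2 i.
    by apply: nbA; left; split=> // z zA; rewrite (nE z a) //; apply: A.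
  apply: nbC; left; split; first by lia.
  by move=> z zC; rewrite (nE z b) //; apply: C.
left=> x y Ix Iy; have [//|xy] := eqVneq x y.
case: (IAC _ Ix) => xI; case: (IAC _ Iy) => yI.
- have [|||full|[i3 I1 Ii]] := path_interval 1 i I.
  + by move=> z Iz; case: (IAC _ Iz) => // zC; case: (meet x z).
  + move=> u v w uI nIu Iv Iw.
    have vI : 1 <= v <= i by case: (IAC _ Iv) => // zC; case: (meet x v).
    have wI : 1 <= w <= i by case: (IAC _ Iw) => // zC; case: (meet x w).
    have := II u v w; rewrite VE uI !eP; [by apply|lia..].
  + by apply.
  + case: nbA; left; split; first by lia.
    by move=> z zA; rewrite (nE z a) //; apply: full.
  + by case: nbA; right; split => //; apply: nE.
- by case: (meet x y).
- by case: (meet y x).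
- have [|||full|[i3 I1 Ii]] := path_interval i.+3 m I.
  + by move=> z Iz; case: (IAC _ Iz) => // zC; case: (meet z x).
  + move=> u v w uI nIu Iv Iw.
    have vI : i.+3 <= v <= m by case: (IAC _ Iv) => // zC; case: (meet v x).
    have wI : i.+3 <= w <= m by case: (IAC _ Iw) => // zC; case: (meet w x).
    have := II u v w; rewrite VE uI !eP ?orbT; [by apply|lia..].
  + by apply.
  + case: nbC; left; split; first by lia.
    by move=> z zA; rewrite (nE z b) //; apply: full.
  + by case: nbC; right; split => //; apply: nE.
Qed.

Local Open Scope fset_scope.

(** * Indecomposability of graphs in terms of predicates, and disconnected graphs *)

Lemma adj_sym {K : choiceType} (G : sgraph K) x y : adj G x y = adj G y x.
Proof. by rewrite /adj fsetUC. Qed.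

Lemma adj_verts (K : choiceType) (G : sgraph K) x y :
  adj G x y -> [/\ x \in verts G, y \in verts G & x != y].
Proof.
rewrite /adj => /(fsubsetP (edges_wf G)); rewrite !inE /= fpowersetE.
by rewrite fsubUset !fsub1set cardfs2 => /andP [/andP [-> ->]]; case: (x == y).
Qed.

Lemma edge_adj {K : choiceType} (G : sgraph K) e :
  e \in edges G -> exists x y, e = [fset x; y] /\ adj G x y.
Proof.
move=> eG; move: (fsubsetP (edges_wf G) _ eG); rewrite !inE /= => /andP [_].
have [->|[x xe]] := fset_0Vmem e; first by rewrite cardfs0.
rewrite (cardfsD1 x) xe => /cardfs1P [y ey].
by exists x, y; rewrite /adj -ey fsetD1K.
Qed.

Lemma indecomposableP (K : choiceType) (G : sgraph K) :
  indecomposable G <-> prime_on (verts G) (adj G).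
Proof.
split=> [/forallP H I [IV II]|H].
  pose J := [fset x in verts G | I x].
  have JE x : (x \in J) = I x.
    by rewrite !inE /=; case E : (I x); rewrite ?andbF // (IV _ E).
  have JV : J `<=` verts G by apply/fsubsetP => x; rewrite JE; apply: IV.
  have JP : J \in fpowerset (verts G) by rewrite fpowersetE.
  have JI : is_interval G J.
    rewrite /is_interval JV; apply/forallP => x; apply/implyP; rewrite JE => Ix.
    apply/orP; have [/existsP [y]|] := boolP [exists y : J, adj G (val x) (val y)].
      move=> e; left; apply/forallP => z.
      by rewrite (II _ (val z) (val y) (valP x) Ix) // -JE; apply: valP.
    by rewrite negb_exists; right.
  have /implyP /= /(_ JI) /or3P [] := H [` JP].
  - by move/eqP => J0; left=> x y; rewrite -!JE J0 inE.
  - by move/eqP => J0; right=> x; rewrite -JE J0.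
  - by case/existsP => u /eqP J1; left=> x y; rewrite -!JE J1 !inE => /eqP -> /eqP ->.
apply/forallP => -[I /=]; rewrite fpowersetE => IV; apply/implyP.
move=> /andP [_ /forallP II].
have [|Isub|Iall] := H (mem I).
- split=> [x|x y z xV xI yI zI]; first exact: (fsubsetP IV).
  have /implyP /(_ xI) /= := II [` xV].
  case/orP => /forallP h; have /= := h [` yI]; have /= := h [` zI].
    by move=> -> ->.
  by move=> /negbTE -> /negbTE ->.
- have [->|[x xI]] := fset_0Vmem I; first by rewrite /trivial_interval eqxx.
  apply/or3P/Or33/existsP; exists [` fsubsetP IV _ xI] => /=.
  apply/eqP/fsetP => y; rewrite inE; apply/idP/eqP => [yI|->//].
  exact: Isub.
- apply/or3P/Or32; rewrite eqEfsubset IV.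
  by apply/fsubsetP => x /Iall.
Qed.

Lemma indecomposable_delP (K : choiceType) (G : sgraph K) X :
  indecomposable (del_verts G X) <-> prime_on (verts G `\` X) (adj G).
Proof.
have VE : verts (del_verts G X) = verts G `\` X.
  by apply/fsetP => x; rewrite !inE; case: (x \in verts G); rewrite ?andbF ?andbT.
have aE x y : x \in verts G `\` X -> y \in verts G `\` X ->
    adj (del_verts G X) x y = adj G x y.
  rewrite adj_rel_graph !inE => /andP [-> ->] /andP [-> ->] /=.
  rewrite (adj_sym _ y) andbb andb_idl //.
  by case/adj_verts.
have iE I : interval_on (verts G `\` X) (adj (del_verts G X)) I
             <-> interval_on (verts G `\` X) (adj G) I.
  by split=> -[IV II]; split=> // x y z xV xI yI zI;
    have := II x y z xV xI yI zI; rewrite !aE //; apply: IV.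
rewrite indecomposableP VE.
by split=> H I /iE /H.
Qed.

(** X and its complement in V are both intervals. The third vertex v lies in one of them, which then
    has two elements without being all of V. *)
Lemma disconnected_not_prime (K : choiceType) (V : {fset K}) (r : rel K)
    (X : pred K) u v w :
  symmetric r -> (forall x, X x -> x \in V) ->
  (forall x y, X x -> y \in V -> ~~ X y -> r x y = false) ->
  X u -> v \in V -> w \in V -> ~~ X w -> u != v -> v != w -> ~ prime_on V r.
Proof.
move=> rC XV r0 Xu vV wV Xw uv vw P.
have [Xv|Xv] := boolP (X v).
  have [|H|H] := P X.
  - by split=> // x y z xV Xx Xy Xz; rewrite !(rC x) !r0.
  - by rewrite (H u v) ?eqxx in uv.
  - by rewrite H in Xw.
have [|H|H] := P (fun x => (x \in V) && ~~ X x).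
- split=> [x /andP [] //|x y z xV].
  rewrite xV negbK => Xx /andP [yV Xy] /andP [zV Xz].
  by rewrite !r0.
- by rewrite (H v w) ?eqxx ?vV ?wV in vw.
- by have /andP [_] := H u (XV _ Xu); rewrite Xu.
Qed.

Lemma mem_N n x : (x \in N_ n) = (1 <= x <= n).
Proof. by rewrite !inE /= mem_iota; lia. Qed.


(** * Neighbourhoods of a vertex n added to the path 1, ..., n - 1 *)

Section PathPlusVertex.
Variables (n : nat) (G : sgraph nat).
Hypotheses (n9 : 9 <= n) (GV : verts G = N_ n)
  (Gpath : forall x y, 1 <= x < n -> 1 <= y < n -> adj G x y = path_adj x y).

Let adjnn x y : adj G x y -> [/\ 1 <= x <= n, 1 <= y <= n & x != y].
Proof. by case/adj_verts; rewrite GV !mem_N. Qed.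

Lemma apex_not_constant b :
  prime_on (N_ n) (adj G) -> ~ (forall x, 1 <= x < n -> adj G n x = b).
Proof.
move=> P Sb; have [|H|H] := P (fun x => 1 <= x < n).
- split=> [x|x y z]; rewrite mem_N; first by lia.
  move=> xn nx yn zn; have -> : x = n by lia.
  by rewrite !Sb.
- by have := H 1 2; lia.
- by have := H n; rewrite mem_N; lia.
Qed.

(** Otherwise {c, n} is a nontrivial interval. *)
Lemma apex_not_twin c :
  prime_on (N_ n) (adj G) -> 1 <= c < n ->
  ~ (forall x, 1 <= x < n -> x != c -> adj G n x = path_adj c x).
Proof.
move=> P cn Sc; have [|H|H] := P (fun x => (x == c) || (x == n)).
- have E x : 1 <= x <= n -> ~~ ((x == c) || (x == n)) -> adj G x c = adj G x n.
    by move=> xn xc; rewrite !(adj_sym G x) Sc ?Gpath //; lia.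
  split=> [x|x y z]; rewrite mem_N; first by lia.
  by move=> xn xc /orP [] /eqP -> /orP [] /eqP ->; rewrite ?E.
- by have := H c n; lia.
- by have := H 1; have := H 2; have := H 3; rewrite !mem_N; lia.
Qed.

Lemma apex_neighbors :
  prime_on (N_ n) (adj G) ->
  (forall i, 2 <= i -> i + 3 <= n ->
     ~ prime_on (N_ n `\` [fset i; i.+1]) (adj G)) ->
  exists k l, [/\ forall x, adj G n x = (k <= x <= l) &
    l = k /\ (3 <= k <= n - 3 \/ k = 1 \/ k = n - 1) \/
    l = k.+1 /\ 2 <= k <= n - 3].
Proof.
move=> P cov.
have exS : exists x, adj G n x.
  apply: NNPP => H; apply: (apex_not_constant false P) => x _.
  by apply/negP => Sx; apply: H; exists x.
have [a Sa amin] := ex_minnP exS.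
have [x /adjnn []|b Sb bmax] := ex_maxnP exS (m := n); first by lia.
have ab := amin _ Sb.
have [_ an na] := adjnn _ _ Sa; have [_ bn nb] := adjnn _ _ Sb.
have Sab x : adj G n x -> a <= x <= b by move=> h; rewrite amin ?bmax.
have S0 x : ~~ (a <= x <= b) -> adj G n x = false by move/negP => h; apply/negP => /Sab.
have twin c := apex_not_twin c P.
have [b3|ab3] := leqP b a.+2.
  exists a, b.
  have S2 x : x != a.+1 -> adj G n x = (a <= x <= b).
    move=> xa; have [xab|/S0 //] := boolP (a <= x <= b).
    have [->//|->//] : x = a \/ x = b by lia.
  have nb2 : b != a.+2.
    apply/eqP => b2; apply: (twin a.+1); first by lia.
    by move=> x xn xa; rewrite S2 // /path_adj; lia.
  have SE x : adj G n x = (a <= x <= b).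
    have [xa|/S2 //] := eqVneq x a.+1.
    have [ba|nba] := eqVneq b a.+1; first by rewrite xa -ba Sb; lia.
    by rewrite S0; lia.
  split=> //.
  (* S = {2} or {1, 2} makes n a twin of 1; S = {n - 2} or {n - 2, n - 1} makes it a twin of n -
     1. *)
  have t1 : ~ (forall x, 1 <= x < n -> x != 1 -> adj G n x = path_adj 1 x).
    by apply: twin; lia.
  have tm : ~ (forall x, 1 <= x < n -> x != n - 1 -> adj G n x = path_adj (n - 1) x).
    by apply: twin; lia.
  have a1 : ~ (b = 2).
    by move=> b2; apply: t1 => x xn x1; rewrite SE /path_adj; lia.
  have am : ~ (a = n - 2).
    by move=> b2; apply: tm => x xn x1; rewrite SE /path_adj; lia.
  by lia.
have seg i : a <= i -> i.+3 <= b ->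
    bad_segment 1 i (adj G n) \/ bad_segment i.+3 (n - 1) (adj G n).
  move=> ai ib.
  have [|] // : prime_on (N_ n `\` [fset i.+1; i.+2]) (adj G) \/
                bad_segment 1 i (adj G n) \/ bad_segment i.+3 (n - 1) (adj G n).
    apply: (two_segments _ _ i (n - 1) n a b) => //; try lia.
    - exact: adj_sym.
    - by move=> x; rewrite inE mem_N !inE; lia.
    - by move=> x y xn yn; apply: Gpath; lia.
  by move=> /cov[]; lia.
(* The segment 1, ..., a meets S only in a, so it is not bad and the other one is; [seg (b - 3)] is
   symmetric. *)
have [] := seg a; [by []|by []| |].
  case=> [[a2 /(_ 1 _)]|[a3 e]]; first by rewrite S0; lia.
  by have := S0 1; rewrite e a3 -a3 Sa; lia.
move=> B1.
have [] := seg (b - 3); [lia|lia| |]; last first.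
  have -> : (b - 3).+3 = b by lia.
  case=> [[b2 /(_ (n - 1) _)]|[b3 e]]; first by rewrite S0; lia.
  by have := S0 (n - 1); rewrite -e Sb; lia.
move=> B2.
(* If S contains both bad segments, then a = 1, b = n - 1 and S is the whole path. The mixed cases
   give b = 6 with n - 1 in S, or a = n - 6 >= 3 with 1 in S. In the last case a = 3 and b = 6, so S
   contains 1 together with 3. *)
case: B1 => [[a2 B1]|[a3 B1]]; case: B2 => [[b2 B2]|[b3 B2]].
- case: (apex_not_constant true P) => x xn.
  have [x3|x3] := leqP x (b - 3); first by apply: B2; lia.
  have S1 : adj G n 1 by apply: B2; lia.
  have S2 : adj G n (n - 1) by apply: B1; lia.
  by apply: B1; have := amin _ S1; have := bmax _ S2; lia.
- have S1 : adj G n (n - 1) by apply: B1; lia.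
  by have := bmax _ S1; lia.
- have S1 : adj G n 1 by apply: B2; lia.
  by have := amin _ S1; lia.
- have a3' : a = 3 by lia.
  by have := S0 1; rewrite B2 b3 -a3' Sa; lia.
Qed.

(** * The graphs with one neighbour or two consecutive neighbours of n *)

Section Converse.
Variables (k l : nat).
Hypotheses (Skl : forall x, adj G n x = (k <= x <= l)) (kl : k <= l <= k.+1)
  (k1 : 0 < k) (ln : l < n).

(** The path has at least 8 vertices, so I meets it in at most one vertex or in all of it. This
    leaves only a twin pair {x, n}, or the whole path without n; the latter would make n adjacent to
    every path vertex. *)
Lemma path_plus_vertex_prime : l != 2 -> k != n - 2 -> prime_on (N_ n) (adj G).
Proof.
move=> l2 kn I [IV II].
have IV' x : I x -> 1 <= x <= n by move=> /IV; rewrite mem_N.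
have II' x y z : 1 <= x <= n -> ~~ I x -> I y -> I z -> adj G x y = adj G x z.
  by move=> xn; apply: II; rewrite mem_N.
have [|||full|[n3 _ _]] := path_interval 1 (n - 1) (fun x => I x && (x != n)); last by lia.
- by move=> x /andP [/IV']; lia.
- move=> x y z xn nIx /andP [Iy yn] /andP [Iz zn].
  have hy := IV' _ Iy; have hz := IV' _ Iz.
  rewrite -!Gpath; try lia.
  by apply: II' => //; [lia|apply: contra nIx => ->; lia].
- move=> sing.
  have [In|nIn] := boolP (I n); last first.
    left=> x y Ix Iy; apply: sing; rewrite ?Ix ?Iy /=.
      by apply: contraNneq nIn => <-.
    by apply: contraNneq nIn => <-.
  left; suff E x : I x -> x = n by move=> x y /E -> /E ->.
  move=> Ix; apply/eqP/negPn/negP => xn.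
  have xn' := IV' _ Ix.
  have T y : 1 <= y < n -> y != x -> (k <= y <= l) = path_adj x y.
    move=> yn yx; rewrite -Skl -Gpath; [|lia|lia].
    rewrite !(adj_sym G _ y); apply: II'; [lia| |by []|by []].
    by apply/negP => Iy; move: yx; rewrite (sing y x) ?eqxx // ?Ix ?Iy; lia.
  (* Two path neighbours of x cannot both lie in [k, l], so x is 1 or n - 1; these twins are
     excluded by [l2] and [kn]. *)
  have := T x.-1; have := T x.+1; have := T k; have := T l.
  by rewrite /path_adj; lia.
have Ix x : 1 <= x < n -> I x by move=> xn; have /andP[] : I x && (x != n) by apply: full; lia.
have [In|nIn] := boolP (I n).
  right=> x; rewrite mem_N => xn; have [->//|xn'] := eqVneq x n.
  by apply: Ix; lia.
have T x : 1 <= x < n -> (k <= x <= l) = true.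
  move=> xn; rewrite -Skl (II' n x k) ?Skl; try apply: Ix; by lia.
by have := T 1; have := T 4; lia.
Qed.

(** If i <= k or j = n, the initial piece 1, ..., i - 1 is cut off. Otherwise j >= k + 2 > l, and
    the final piece j + 1, ..., n - 1 is cut off. *)
Lemma path_plus_vertex_del i j :
  2 <= i <= n - 2 -> i < j <= n -> j != n - 1 ->
  ~ prime_on (N_ n `\` [fset i; j]) (adj G).
Proof.
move=> ib jb jn.
(* A remaining vertex other than 1 and n - 1, as [disconnected_not_prime] asks for three. *)
have [v [v2 vi vj]] : exists v, [/\ 2 <= v <= 4, v != i & v != j].
  have [i2|i2] := eqVneq i 2; have [j3|j3] := eqVneq j 3.
  - by exists 4; split; lia.
  - by exists 3; split; lia.
  - by exists 2; split; lia.
  - by exists 2; split; lia.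
have E x : (x \in N_ n `\` [fset i; j]) = [&& 1 <= x <= n, x != i & x != j].
  by rewrite inE mem_N !inE; lia.
have [ik|ki] := boolP ((i <= k) || (j == n)).
  apply: (disconnected_not_prime _ _ _ (fun x => 1 <= x < i) 1 v (n - 1));
    rewrite ?E; try lia.
  - exact: adj_sym.
  - by move=> x; rewrite E; lia.
  - move=> x y xi; rewrite E => yV yX.
    have [yn|yn] := eqVneq y n; first by rewrite yn adj_sym Skl; lia.
    by rewrite Gpath /path_adj; lia.
apply: (disconnected_not_prime _ _ _ (fun x => j < x < n) (n - 1) v 1);
  rewrite ?E; try lia.
- exact: adj_sym.
- by move=> x; rewrite E; lia.
- move=> x y xi; rewrite E => yV yX.
  have [yn|yn] := eqVneq y n; first by rewrite yn adj_sym Skl; lia.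
  by rewrite Gpath /path_adj; lia.
Qed.

End Converse.
End PathPlusVertex.

(** * The characterization of $\mathcal{P}_{-1}$ *)

Lemma N_inj : injective N_.
Proof.
move=> m n E; have H x : (1 <= x <= m) = (1 <= x <= n) by rewrite -!mem_N E.
by have := H m; have := H n; lia.
Qed.

Lemma del_last_path n (G : sgraph nat) :
  verts G = N_ n -> del_verts G [fset n] = path_graph n.-1 ->
  forall x y, 1 <= x < n -> 1 <= y < n -> adj G x y = path_adj x y.
Proof.
move=> GV D x y xn yn.
have : adj (del_verts G [fset n]) x y = adj (path_graph n.-1) x y by rewrite D.
rewrite !adj_rel_graph GV !in_fsetI !in_fsetD !in_fset1 !mem_N (adj_sym G y x) andbb.
have [->|xy] := eqVneq x y.
  move=> _; rewrite /path_adj; apply/idP/idP => [/adj_verts []|]; first by rewrite eqxx.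
  by lia.
by rewrite /path_adj; lia.
Qed.

Theorem proposition4p1 (n : nat) (hn : 9 <= n)
    (G : sgraph nat) (hG : verts G = N_ n) :
  P_minus1 G <->
  (del_verts G [fset n] = path_graph n.-1 /\
   ((exists k : nat, (3 <= k <= n - 3 \/ k = 1 \/ k = n - 1) /\
                     neighbors G n = [fset k])
    \/
    (exists k : nat, 2 <= k <= n - 3 /\
                     neighbors G n = [fset k; k.+1]))).
Proof.
have nE x : (x \in neighbors G n) = adj G n x.
  by rewrite !inE /=; apply: andb_idl => /adj_verts [].
split.
  case=> n' [_ GV']; have <- : n = n' by apply: N_inj; rewrite -hG.
  move=> /indecomposableP P cov D; split=> //.
  have Gp := del_last_path n G hG D.
  rewrite hG in P.
  have [|k [l [SE]]] := apex_neighbors n G hn hG Gp P.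
    move=> i i2 ni Pi.
    (* This edge would avoid 1 and n - 1, since 2 <= i and i + 1 <= n - 2. *)
    have [|x] := cov [fset i; i.+1]; last by rewrite !inE; lia.
    rewrite -/(adj (indec_graph G) i i.+1) adj_rel_graph hG !mem_N (fsetUC [fset i.+1]).
    have -> : indecomposable (del_verts G [fset i; i.+1]).
      by apply/indecomposable_delP; rewrite hG.
    by lia.
  case=> -[lk kb]; [left|right]; exists k; split=> //; apply/fsetP => x;
    by rewrite nE SE !inE lk; lia.
case=> D H.
have Gp := del_last_path n G hG D.
(* Both shapes are segments [k, l]; the bounds on k rule out the twins of 1 and n - 1. *)
have [k [l [SE kl k1 l2]]] : exists k l, [/\ forall x, adj G n x = (k <= x <= l),
    k <= l <= k.+1, 0 < k < n & [/\ l != 2, k != n - 2 & l < n]].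
  case: H => -[k [kb NE]]; [exists k, k|exists k, k.+1]; do ?split; try lia;
    by move=> x; rewrite -nE NE !inE; lia.
have [l2' kn ln] := l2; have [k0 _] := andP k1.
exists n; split=> //.
  apply/indecomposableP; rewrite hG.
  exact: (path_plus_vertex_prime n G hn Gp k l).
move=> _ /edge_adj [x [y [->]]]; rewrite adj_rel_graph hG !mem_N.
move=> /and5P [xn yn xy P1 P2].
have N i j : i < j -> 1 <= i <= n -> 1 <= j <= n ->
    indecomposable (del_verts G [fset i; j]) ->
    [|| i == 1, i == n - 1, j == 1 | j == n - 1].
  move=> ij ib jb /indecomposable_delP; rewrite hG => P.
  apply/negPn/negP => ne.
  by apply: (path_plus_vertex_del n G hn Gp k l SE kl k0 ln i j _ _ _ P); lia.
have : [|| x == 1, x == n - 1, y == 1 | y == n - 1].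
  have [xy'|yx|xy'] := ltngtP x y; [exact: N| |by rewrite xy' eqxx in xy].
  by have := N _ _ yx yn xn P2; lia.
case/or4P => /eqP E; [exists x|exists x|exists y|exists y]; rewrite !inE; lia.
Qed.
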